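(* Let $n\ge 4$ and let $D$ be a bipartite demand graph with base graph $K_{n,n}$, i.e., $V(D)=V(K_{n,n})$ and every edge of $D$ joins a vertex of one color class of $K_{n,n}$ to a vertex of the other. If $D$ has at most $2n-2$ edges and $\Delta(D)\le n$, then $D$ is resolvable in $K_{n,n}$.
   Context: A demand graph on the vertex set of a simple base graph $G$ is a loopless multigraph $D$ with $V(D)=V(G)$ (parallel edges allowed; edges counted with multiplicity). $D$ is resolvable in $G$ if one can assign to each edge of $D$ (counted with multiplicity) a path in $G$ joining the two endpoints of that edge, such that the assigned paths are pairwise edge-disjoint. $\Delta(D)$ is the maximum degree of $D$, counting edges with multiplicity. *)

(* Defs.v *)
From HB Require Import structures.
From mathcomp Require Import all_boot.

Set Implicit Arguments.
Unset Strict Implicit.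
Unset Printing Implicit Defensive.

Record sgraph := SGraph {
  vertex :> finType;
  adj : rel vertex;
  adj_sym : symmetric adj;
  adj_irrefl : irreflexive adj }.

(* Distinct elements of [edge D] may have the same set of endpoints: these are
   the parallel edges.  Looplessness is the requirement of two endpoints. *)
Record multigraph (V : finType) := Multigraph {
  edge : finType;
  ends : edge -> {set V};
  card_ends : forall e, #|ends e| = 2 }.

Definition degree (V : finType) (D : multigraph V) (v : V) : nat :=
  #|[set e : edge D | v \in ends e]|.

Definition max_degree (V : finType) (D : multigraph V) : nat :=
  \max_(v : V) degree D v.

(* The pair [w] stands for the nonempty vertex sequence [w.1 :: w.2]; a path
   does not repeat vertices. *)
Definition is_path (G : sgraph) (w : G * seq G) : bool :=
  path (@adj G) w.1 w.2 && uniq (w.1 :: w.2).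

Definition path_ends (V : finType) (w : V * seq V) : {set V} :=
  [set w.1; last w.1 w.2].

Definition path_edges (V : finType) (w : V * seq V) : seq {set V} :=
  pairmap (fun x y => [set x; y]) w.1 w.2.

Definition edge_disjoint (V : finType) (w1 w2 : V * seq V) : Prop :=
  forall a : {set V}, a \in path_edges w1 -> a \notin path_edges w2.

Definition resolvable (G : sgraph) (D : multigraph G) : Prop :=
  exists P : edge D -> G * seq G,
    (forall e, is_path (P e) /\ path_ends (P e) = ends e) /\
    (forall e f, e != f -> edge_disjoint (P e) (P f)).

Definition is_inl (A B : Type) (x : A + B) : bool :=
  if x is inl _ then true else false.

Definition Knn_adj (n : nat) : rel ('I_n + 'I_n)%type :=
  fun x y => is_inl x != is_inl y.

Lemma Knn_sym n : symmetric (@Knn_adj n).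
Proof. by move=> x y; rewrite /Knn_adj eq_sym. Qed.

Lemma Knn_irrefl n : irreflexive (@Knn_adj n).
Proof. by move=> x; rewrite /Knn_adj eqxx. Qed.

Definition Knn (n : nat) : sgraph := SGraph (@Knn_sym n) (@Knn_irrefl n).

Definition bipartite_demand (n : nat) (D : multigraph (Knn n)) : Prop :=
  forall e : edge D, exists i j : 'I_n,
    ends e = [set (inl i : Knn n); (inr j : Knn n)].

(* Main.v *)
Require Import Defs.
From mathcomp Require Import all_boot.
From mathcomp Require Import zify.

Set Implicit Arguments.
Unset Strict Implicit.
Unset Printing Implicit Defensive.

(* Demands are cells (row, column) of the grid of edges of K_{n,n}. Besides
   serving a demand by its own edge, one may slide it: (i, j) becomes (i', j) at
   the cost of the edges (i, j') and (i', j'), and likewise for columns. By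
   padding, assume there are exactly 2n-2 demands, and induct on n: delete a row
   a and a column b after using edges at a or b to dispose of at least two
   demands and to lower the at most one row and one column of degree n.
   This works when no line is empty (delete two non-adjacent lines of degree 1),
   and when there are an empty row a and a nonempty column b without repeated
   cells (serve b directly, and one further demand through a and b).
   Otherwise there are an empty row and an empty column, and every nonempty line
   contains a repeated cell; then one deletes two rows and two columns and
   disposes of four demands. The case n = 4, and the last case for n = 5, are
   checked by computation, up to sorting rows and columns by degree. *)

(** * Routing in a grid *)

Section Routing.

Variables A B : finType.
Implicit Types (X Y : pred (A * B)) (R : {set A}) (C : {set B}).
Implicit Types (U L : seq (A * B)) (i : A) (j : B) (p : A * B).

(** Rows and columns are the vertices of a complete bipartite graph, and the cell [(i, j)] is the
    edge between row [i] and column [j]; [X] selects the edges that may be used. *)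
Definition link X : rel (A + B)%type := fun x y =>
  match x, y with
  | inl i, inr j | inr j, inl i => X (i, j)
  | _, _ => false
  end.

Definition joined X p := connect (link X) (inl p.1) (inr p.2).

Lemma link_sym X : symmetric (link X).
Proof. by move=> [i|j] [i'|j']. Qed.

Lemma link_sub X Y : {subset X <= Y} -> subrel (link X) (link Y).
Proof. by move=> sXY [i|j] [i'|j'] //=; apply: sXY. Qed.

Lemma connect_link_sub X Y : {subset X <= Y} ->
  subrel (connect (link X)) (connect (link Y)).
Proof. by move=> sXY; apply: connect_sub => x y /(link_sub sXY)/connect1. Qed.

Lemma joined_sub X Y p : {subset X <= Y} -> joined X p -> joined Y p.
Proof. by move=> sXY; apply: connect_link_sub. Qed.

Definition free R C U : pred (A * B) :=
  fun p => [&& p.1 \in R, p.2 \in C & p \notin U].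

(* The cells of the grid [R * C] outside [U] are coloured by (indices of)
   demands; a demand must be joined within its own colour class. *)
Definition routable R C U L := exists f : A * B -> nat, forall p0 k,
  k < size L -> joined (fun p => free R C U p && (f p == k)) (nth p0 L k).

Lemma routable_nil R C U : routable R C U [::].
Proof. by exists (fun=> 0). Qed.

Lemma routable_drop R C U p L : routable R C U (p :: L) -> routable R C U L.
Proof.
(* The cells of the dropped demand get the colour [size L], which is the index of no demand. *)
move=> [f fP]; exists (fun q => (f q).-1 + (f q == 0) * size L) => p0 k kL.
have := fP p0 k.+1 kL; apply: joined_sub => q; rewrite !unfold_in /=.
by case/andP=> -> /eqP->; rewrite /= addn0 eqxx.
Qed.

Lemma routable_perm R C U L L' :
  perm_eq L L' -> routable R C U L -> routable R C U L'.
Proof.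
rewrite perm_sym; case: L => [|p L]; first by move/perm_nilP->; exact.
move=> /(perm_iotaP p) [s s_iota ->] [f fP].
(* [s] lists the old positions of the demands of [L'], so [index _ s] turns an old position into the
   new one. *)
exists (fun q => index (f q) s) => p0 k; rewrite size_map => ks.
have us : uniq s by rewrite (perm_uniq s_iota) iota_uniq.
have sk : nth 0 s k \in iota 0 (size (p :: L)).
  by rewrite -(perm_mem s_iota) mem_nth.
rewrite mem_iota /= add0n in sk.
rewrite (nth_map 0) // .
have := fP p _ sk; apply: joined_sub => q; rewrite !unfold_in /=.
by case/andP=> -> /eqP->; rewrite /= index_uniq.
Qed.

(** The cell [p] receives colour 0 and all other colours move up by one; since [p] counts as used
    afterwards, no other demand needs it. *)
Lemma routable_edge R C U p L : free R C U p ->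
  routable R C (p :: U) L -> routable R C U (p :: L).
Proof.
move=> Fp [f fP]; exists (fun q => if q == p then 0 else (f q).+1) => p0 [_|k] /=.
  by apply: connect1; move: fP; case: p Fp => i j Fp _ /=; rewrite Fp eqxx.
rewrite ltnS => kL; have := fP p0 k kL; apply: joined_sub => q.
rewrite !unfold_in /= /free in_cons negb_or.
by case/andP=> /and4P[-> -> /negPf-> ->] /=; rewrite eqSS => ->.
Qed.

(** The walk goes from row [i] through column [j'] to row [i'], and continues as the route of the
    demand [(i', j)]. It may repeat vertices, because only connectedness within a colour class is
    required. *)
Lemma routable_row_shift R C U i i' j j' L :
    free R C U (i, j') -> free R C U (i', j') ->
    routable R C [:: (i, j'), (i', j') & U] ((i', j) :: L) ->
  routable R C U ((i, j) :: L).
Proof.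
move=> F1 F2 [f fP].
pose f' q := if (q == (i, j')) || (q == (i', j')) then 0 else f q.
have sub k : {subset
    (fun q => free R C [:: (i, j'), (i', j') & U] q && (f q == k)) <=
    (fun q => free R C U q && (f' q == k))}.
  move=> q; rewrite !unfold_in /f' /free !in_cons !negb_or.
  by case/andP=> /and5P[-> -> /negPf-> /negPf-> ->] /= ->.
have F3 : link (fun q => free R C U q && (f' q == 0)) (inl i) (inr j').
  by rewrite /= F1 /f' eqxx.
have F4 : link (fun q => free R C U q && (f' q == 0)) (inr j') (inl i').
  by rewrite /= F2 /f' eqxx orbT.
exists f' => p0 [|k] /= kL; last exact: joined_sub (sub _) (fP p0 k.+1 kL).
have := joined_sub (sub 0) (fP p0 0 isT).
rewrite /joined; apply: connect_trans.
exact: connect_trans (connect1 F3) (connect1 F4).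
Qed.

(** This is how lines are deleted: all used cells lie outside the smaller grid, which therefore
    starts with no used cell. *)
Lemma routable_sub R C U L R' C' :
    R' \subset R -> C' \subset C ->
    {in U, forall p, (p.1 \notin R') || (p.2 \notin C')} ->
  routable R' C' [::] L -> routable R C U L.
Proof.
move=> /subsetP sR /subsetP sC UP [f fP]; exists f => p0 k kL.
have := fP p0 k kL; apply: joined_sub => p.
rewrite !unfold_in /= /free => /andP[/and3P[pR pC _] ->].
rewrite andbT sR // sC //=; apply/negP => /UP.
by rewrite pR pC.
Qed.

End Routing.

Definition swap {A B : Type} (p : A * B) : B * A := (p.2, p.1).

Lemma swapK (A B : Type) : cancel (@swap A B) swap.
Proof. by case. Qed.

(** Transposition turns a walk from row to column into one from column to row, and connectedness is
    symmetric. Statements about columns are obtained from those about rows in this way. *)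
Lemma routable_swap (A B : finType) (R : {set A}) (C : {set B}) U L :
  routable R C U L -> routable C R (map swap U) (map swap L).
Proof.
move=> [f fP]; exists (fun p => f (swap p)) => p0 k; rewrite size_map => kL.
have := fP (swap p0) k kL; rewrite (nth_map (swap p0)) //.
move: (nth _ _ _) => [i j]; rewrite /joined /=.
set X := fun p => _; set Y := fun p => _.
have XY p : X p -> Y (swap p).
  rewrite /X /Y /free swapK (mem_map (can_inj (@swapK A B))) /=.
  by case/andP=> /and3P[-> -> ->] ->.
pose g (x : A + B) : B + A := match x with inl i => inr i | inr j => inl j end.
have gP x y : link X x y -> connect (link Y) (g x) (g y).
  by case: x y => [x|x] [y|y] //= /XY h; apply: connect1.
rewrite (sym_connect_sym (link_sym Y)) => /connectP[s].
change (connect (link Y) (inr i) (inl j))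
  with (connect (link Y) (g (inl i)) (g (inr j))) => sP ->.
elim: s {i}(inl i : A + B)%type sP => [|y s IH] x /=; first by rewrite connect0.
by case/andP=> /gP xy /IH; apply: connect_trans.
Qed.

Lemma routable_swapK (A B : finType) (R : {set A}) (C : {set B}) U L :
  routable C R (map swap U) (map swap L) -> routable R C U L.
Proof. by move/routable_swap; rewrite !(mapK (@swapK A B)). Qed.

Lemma routable_col_shift (A B : finType) (R : {set A}) (C : {set B})
    U i i' j j' L :
    free R C U (i', j) -> free R C U (i', j') ->
    routable R C [:: (i', j), (i', j') & U] ((i, j') :: L) ->
  routable R C U ((i, j) :: L).
Proof.
have F p : free R C U p -> free C R (map swap U) (swap p).
  by rewrite /free (mem_map (can_inj (@swapK A B))) => /and3P[-> -> ->].
move=> /F F1 /F F2 /routable_swap /= S; apply: routable_swapK.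
exact: routable_row_shift F1 F2 S.
Qed.

(** The demand takes the path of three edges through column [j'] and row [i']: a slide to [(i', j)]
    followed by that cell's own edge. *)
Lemma routable_path (A B : finType) (R : {set A}) (C : {set B}) U i i' j j' L :
    j != j' ->
    free R C U (i, j') -> free R C U (i', j') -> free R C U (i', j) ->
    routable R C [:: (i', j), (i, j'), (i', j') & U] L ->
  routable R C U ((i, j) :: L).
Proof.
move=> jj F1 F2 /and3P[iR jC nU] S; apply: (routable_row_shift F1 F2).
apply: routable_edge S; rewrite /free iR jC !in_cons !negb_or nU.
by rewrite !xpair_eqE (negPf jj) !andbF.
Qed.

(** * Degrees *)

Ltac nlia := repeat match goal with
  | H : is_true (_ \in _) |- _ => clear H
  | H : is_true (~~ _) |- _ => clear H
  | H : is_true (perm_eq _ _) |- _ => clear H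
  end; lia.

Ltac use_neq := rewrite ?eqxx; repeat match goal with
  | H : is_true (?x != ?y) |- context [?x == ?y] => rewrite (negPf H)
  | H : is_true (?x != ?y) |- context [?y == ?x] => rewrite (eq_sym y x) (negPf H)
  end; rewrite ?andbF ?andbT ?orbF ?orbT /=.

Ltac free_cell := rewrite /free /= ?in_cons ?in_nil ?xpair_eqE;
  repeat match goal with H : is_true (_ \in _) |- _ => rewrite H end;
  use_neq; try done.

Definition rdeg (A B : eqType) (L : seq (A * B)) i := count (fun p => p.1 == i) L.
Definition cdeg (A B : eqType) (L : seq (A * B)) j := count (fun p => p.2 == j) L.

Lemma rdeg_swap (A B : eqType) (L : seq (A * B)) j : rdeg (map swap L) j = cdeg L j.
Proof. by rewrite /rdeg count_map. Qed.

Lemma cdeg_swap (A B : eqType) (L : seq (A * B)) i : cdeg (map swap L) i = rdeg L i.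
Proof. by rewrite /cdeg count_map. Qed.

Lemma perm_cons_rem (A B : finType) (p : A * B) (L : seq (A * B)) :
  p \in L -> exists L' : seq (A * B), perm_eq L (p :: L').
Proof. by move=> pL; exists (rem p L); apply: perm_to_rem. Qed.

Lemma perm_rdeg (A B : eqType) (L L' : seq (A * B)) :
  perm_eq L L' -> rdeg L =1 rdeg L'.
Proof. by move=> E i; apply: (permP E). Qed.

Lemma perm_cdeg (A B : eqType) (L L' : seq (A * B)) :
  perm_eq L L' -> cdeg L =1 cdeg L'.
Proof. by move=> E i; apply: (permP E). Qed.

Lemma rdeg_cons (A B : eqType) (p : A * B) (L : seq (A * B)) i :
  rdeg (p :: L) i = (p.1 == i) + rdeg L i.
Proof. by []. Qed.

Lemma cdeg_cons (A B : eqType) (p : A * B) (L : seq (A * B)) j :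
  cdeg (p :: L) j = (p.2 == j) + cdeg L j.
Proof. by []. Qed.

Lemma rdeg_gt0 (A B : eqType) (L : seq (A * B)) i :
  0 < rdeg L i -> exists j, (i, j) \in L.
Proof. by rewrite -has_count => /hasP[[i' j] pL /= /eqP <-]; exists j. Qed.

Lemma cdeg_gt0 (A B : eqType) (L : seq (A * B)) j :
  0 < cdeg L j -> exists i, (i, j) \in L.
Proof. by rewrite -has_count => /hasP[[i j'] pL /= /eqP <-]; exists i. Qed.

Lemma mem_rdeg (A B : eqType) (L : seq (A * B)) p : p \in L -> 0 < rdeg L p.1.
Proof. by move=> pL; rewrite -has_count; apply/hasP; exists p => /=. Qed.

Lemma mem_cdeg (A B : eqType) (L : seq (A * B)) p : p \in L -> 0 < cdeg L p.2.
Proof. by move=> pL; rewrite -has_count; apply/hasP; exists p => /=. Qed.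

Lemma rdeg_add_le (A B : finType) (L : seq (A * B)) i i' :
  i != i' -> rdeg L i + rdeg L i' <= size L.
Proof.
move=> ii; elim: L => //= p L; rewrite /rdeg /=.
by case: eqP => [->|_]; use_neq; nlia.
Qed.

Lemma cdeg_add_le (A B : finType) (L : seq (A * B)) j j' :
  j != j' -> cdeg L j + cdeg L j' <= size L.
Proof.
by move=> jj; rewrite -!rdeg_swap -(size_map swap); apply: rdeg_add_le.
Qed.

Lemma rdeg_add3_le (A B : finType) (L : seq (A * B)) i i' i'' :
  i != i' -> i != i'' -> i' != i'' ->
  rdeg L i + rdeg L i' + rdeg L i'' <= size L.
Proof.
move=> n1 n2 n3; elim: L => //= p L; rewrite /rdeg /=.
by case: eqP => [->|_]; [|case: eqP => [->|_]]; use_neq; nlia.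
Qed.

Lemma cdeg_add3_le (A B : finType) (L : seq (A * B)) j j' j'' :
  j != j' -> j != j'' -> j' != j'' ->
  cdeg L j + cdeg L j' + cdeg L j'' <= size L.
Proof.
by move=> *; rewrite -!rdeg_swap -(size_map swap); apply: rdeg_add3_le.
Qed.

(** The hypotheses of the theorem for an [m] by [m] grid. Rows and columns are subsets of fixed
    types, so that deleting a line only shrinks a set. *)
Record admissible (A B : finType) m (R : {set A}) (C : {set B})
    (L : seq (A * B)) : Prop := {
  card_rows : #|R| = m;
  card_cols : #|C| = m;
  rows_in : {in L, forall p, p.1 \in R};
  cols_in : {in L, forall p, p.2 \in C};
  size_bound : size L <= 2 * m - 2;
  rdeg_bound : forall i, rdeg L i <= m;
  cdeg_bound : forall j, cdeg L j <= m }.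

Lemma admissible_swap (A B : finType) m (R : {set A}) (C : {set B})
    (L : seq (A * B)) :
  admissible m R C L -> admissible m C R (map swap L).
Proof.
case=> cR cC LR LC sL rL cL; split; rewrite ?size_map //.
- by move=> _ /mapP[p /LC ? ->].
- by move=> _ /mapP[p /LR ? ->].
- by move=> j; rewrite rdeg_swap.
- by move=> i; rewrite cdeg_swap.
Qed.

(** Quantifying over the types too makes the induction hypothesis applicable to the transposed
    grid. *)
Definition all_routable m :=
  forall (A B : finType) (R : {set A}) (C : {set B}) (L : seq (A * B)),
  admissible m R C L -> routable R C [::] L.

Section Sums.

Variables (A B : finType) (R : {set A}).
Implicit Types L : seq (A * B).

Lemma sum_rdeg L : {in L, forall p, p.1 \in R} -> \sum_(i in R) rdeg L i = size L.
Proof.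
elim: L => [|p L IH] LR; first by rewrite big1.
rewrite (eq_bigr (fun i => (p.1 == i) + rdeg L i)) //.
rewrite big_split /= IH => [|q qL]; last by rewrite LR // in_cons qL orbT.
rewrite (bigD1 p.1) /=; last by rewrite LR // mem_head.
rewrite eqxx big1 // => i /andP[_ ip]; by rewrite eq_sym (negPf ip).
Qed.

(** Each row satisfies [2 <= rdeg L i + (rdeg L i == 1)]. Summing over the rows, the number of rows
    of degree 1 is at least [2 * #|R| - size L]. *)
Lemma many_deg1 L : {in L, forall p, p.1 \in R} -> size L <= 2 * #|R| - 2 ->
  {in R, forall i, 0 < rdeg L i} -> 0 < #|R| ->
  1 < #|[set i in R | rdeg L i == 1]|.
Proof.
move=> LR sL pos R0; rewrite -sum1_card.
have: \sum_(i in R) 2 <= \sum_(i in R) (rdeg L i + (rdeg L i == 1)).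
  by apply: leq_sum => i /pos; nlia.
rewrite big_split /= sum_rdeg // sum_nat_const -big_mkcondr /=.
under [X in _ -> _ < X]eq_bigl do rewrite inE.
nlia.
Qed.

Lemma rdeg_notin L i : {in L, forall p, p.1 \in R} -> i \notin R -> rdeg L i = 0.
Proof.
move=> LR iR; apply/eqP; rewrite -leqn0 leqNgt -has_count; apply/hasP.
by case=> p /LR pR /eqP pi; rewrite -pi pR in iR.
Qed.

(** Each of the [#|R| - 1] other rows takes at least one of the [2 * #|R| - 2] demands. *)
Lemma rdeg_lt_card L i : {in L, forall p, p.1 \in R} -> size L <= 2 * #|R| - 2 ->
  {in R, forall i, 0 < rdeg L i} -> i \in R -> rdeg L i < #|R|.
Proof.
move=> LR sL pos iR; have := sum_rdeg LR; rewrite (bigD1 i) //= => E.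
have: \sum_(k in R | k != i) 1 <= \sum_(k in R | k != i) rdeg L k.
  by apply: leq_sum => k /andP[/pos].
have : #|R| = 1 + \sum_(k in R | k != i) 1 by rewrite -sum1_card (bigD1 i).
nlia.
Qed.

End Sums.

(** * Induction step when no row and no column is empty *)

Section Steps.

Variables (A B : finType) (m : nat).
Hypothesis IH : all_routable m.
Variables (R : {set A}) (C : {set B}) (L : seq (A * B)).
Hypothesis adm : admissible m.+1 R C L.
Hypothesis m_ge : 3 < m.

(** A row [a] and a column [b] of degree 1 with different demands are deleted once these two demands
    are served by their own edges. All remaining degrees are at most [m], because no line was
    empty. *)
Lemma routable_no_zero :
  {in R, forall i, 0 < rdeg L i} -> {in C, forall j, 0 < cdeg L j} ->
  routable R C [::] L.
Proof.
case: adm => cR cC LR LC sL rL cL rpos cpos.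
have cLR : {in map swap L, forall p, p.1 \in C} by move=> _ /mapP[p /LC ? ->].
have cpos' : {in C, forall j, 0 < rdeg (map swap L) j}.
  by move=> j /cpos; rewrite rdeg_swap.
have [a aR a1] : exists2 a, a \in R & rdeg L a = 1.
  have : 0 < #|[set i in R | rdeg L i == 1]|.
    by apply: ltnW; apply: many_deg1 => //; rewrite cR.
  by case/card_gt0P=> a; rewrite inE => /andP[? /eqP]; exists a.
have [j ajL] : exists j, (a, j) \in L by apply: rdeg_gt0; rewrite a1.
(* Of two columns of degree 1, one differs from [j]; with it, [(a, b)] is not a demand. *)
have [b [bC b1 jb]] : exists b, [/\ b \in C, cdeg L b = 1 & j != b].
  have : 1 < #|[set k in C | rdeg (map swap L) k == 1]|.
    by apply: many_deg1 => //; rewrite ?size_map ?cC; nlia.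
  case/card_gt1P=> b1 [b2 []]; rewrite !inE !rdeg_swap.
  move=> /andP[h1 /eqP h2] /andP[h3 /eqP h4] h5.
  case: (eqVneq j b1) => [->|n1]; [exists b2|exists b1]; split => //.
have [i ibL] : exists i, (i, b) \in L by apply: cdeg_gt0; rewrite b1.
have [L1 E1] := perm_cons_rem ajL.
have ib1 : (i, b) \in L1.
  by move: ibL; rewrite (perm_mem E1) in_cons xpair_eqE; use_neq.
have [L2 E2] := perm_cons_rem ib1.
have E : perm_eq L [:: (a, j), (i, b) & L2].
  by rewrite (permPl E1) perm_cons.
have rE k : rdeg L k = (a == k) + ((i == k) + rdeg L2 k).
  by rewrite (perm_rdeg E) !rdeg_cons.
have cE k : cdeg L k = (j == k) + ((b == k) + cdeg L2 k).
  by rewrite (perm_cdeg E) !cdeg_cons.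
have ai : a != i by apply/eqP => ai; move: a1; rewrite rE -ai eqxx.
have L2L : {subset L2 <= L} by move=> p pL; rewrite (perm_mem E) !inE pL !orbT.
apply: (@routable_perm _ _ _ _ _ [:: (a, j), (i, b) & L2]).
  by rewrite perm_sym.
have jC := LC _ ajL; have iR := LR _ ibL; rewrite /= in jC iR.
apply: routable_edge; first by free_cell.
apply: routable_edge; first by free_cell.
apply: (@routable_sub _ _ _ _ _ _ (R :\ a) (C :\ b)); rewrite ?subsetDl //.
  by move=> p; rewrite !inE => /orP[] /eqP->; rewrite /= eqxx ?orbT.
apply: IH; split.
- by move: (cardsD1 a R); rewrite aR cR add1n => -[].
- by move: (cardsD1 b C); rewrite bC cC add1n => -[].
- move=> p pL; rewrite !inE LR ?L2L // andbT; apply/eqP => pa.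
  move: a1 (mem_rdeg pL); rewrite rE eqxx pa; use_neq.
  by rewrite !add0n add1n; case=> ->.
- move=> p pL; rewrite !inE LC ?L2L // andbT; apply/eqP => pb.
  move: b1 (mem_cdeg pL); rewrite cE eqxx pb; use_neq.
  by rewrite !add0n add1n; case=> ->.
- by move: sL (perm_size E) => /=; nlia.
- move=> k; case: (boolP (k \in R)) => kR.
    have : rdeg L k < #|R| by apply: rdeg_lt_card => //; rewrite cR; nlia.
    by rewrite cR rE; nlia.
  by move: (rdeg_notin LR kR); rewrite rE; nlia.
- move=> k; case: (boolP (k \in C)) => kC.
    have : rdeg (map swap L) k < #|C|.
      by apply: rdeg_lt_card => //; rewrite ?size_map cC; nlia.
    by rewrite cC rdeg_swap cE; nlia.
  by move: (rdeg_notin cLR kC); rewrite rdeg_swap cE; nlia.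
Qed.

End Steps.

Lemma routable_subU (A B : finType) (R : {set A}) (C : {set B}) U U' L :
  {subset U' <= U} -> routable R C U L -> routable R C U' L.
Proof.
move=> sU [f fP]; exists f => p0 k kL; have := fP p0 k kL.
apply: joined_sub => p; rewrite !unfold_in /= /free.
by case/andP=> /and3P[-> -> pU] ->; rewrite andbT /=; apply: contra pU => /sU.
Qed.

Lemma routable_edges (A B : finType) (R : {set A}) (C : {set B}) U s L :
  uniq s -> {in s, forall p, free R C U p} ->
  routable R C (s ++ U) L -> routable R C U (s ++ L).
Proof.
elim: s U => [|p s IH] U //= /andP[ps us] sF S.
apply: routable_edge; first by rewrite sF ?mem_head.
apply: IH => // [q qs|]; last first.
  by apply: routable_subU S => q; rewrite !(mem_cat, in_cons) orbCA.
have := sF q; rewrite in_cons qs orbT => /(_ isT).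
rewrite /free in_cons negb_or => /and3P[-> -> ->]; rewrite !andbT /=.
by apply: contraNneq ps => <-.
Qed.

Lemma card_setD1_pred (T : finType) (S : {set T}) x n :
  x \in S -> #|S| = n.+1 -> #|S :\ x| = n.
Proof. by move=> xS; rewrite (cardsD1 x) xS add1n => -[]. Qed.

Lemma routable_shrink (A B : finType) m (R R' : {set A}) (C C' : {set B}) U L :
    all_routable m -> R' \subset R -> C' \subset C ->
    {in U, forall p, (p.1 \notin R') || (p.2 \notin C')} ->
  admissible m R' C' L -> routable R C U L.
Proof. by move=> IH sR sC UP /IH; apply: routable_sub. Qed.

(** * Induction step for an empty row and a nonempty column without repeated cells *)

Section ZeroRow.

Variables (A B : finType) (m : nat).
Hypothesis IH : all_routable m.
Hypothesis m_ge : 3 < m.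
Variables (R : {set A}) (C : {set B}) (a : A) (b : B).
Hypotheses (cR : #|R| = m.+1) (cC : #|C| = m.+1) (aR : a \in R) (bC : b \in C).

(* The edges at [a] serve to lower the degree of a column of degree [m.+1]. *)
Lemma routable_finish (U L : seq (A * B)) j0 :
    {in U, forall p, (p.1 == a) || (p.2 == b)} ->
    {in L, forall p, p.1 \in R :\ a} -> {in L, forall p, p.2 \in C :\ b} ->
    size L <= 2 * m - 2 -> (forall i, rdeg L i <= m) ->
    (forall j, cdeg L j <= m.+1) -> cdeg L j0 <= m ->
    (forall j, j != b -> j != j0 -> (a, j) \notin U) ->
  routable R C U L.
Proof.
move=> UP LR LC sL rL cL cj0 Uj.
have UP' : {in U, forall p, (p.1 \notin R :\ a) || (p.2 \notin C :\ b)}.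
  by move=> p /UP /orP[] /eqP->; rewrite !inE eqxx ?orbT.
(* At most one column is too full, since two of degree [m.+1] would need [2 * m + 2] demands. *)
case: (pickP (fun y => cdeg L y == m.+1)) => [y /eqP cy|cm]; last first.
  apply: (routable_shrink IH _ _ UP'); rewrite ?subsetDl //.
  split=> //; try exact: card_setD1_pred.
  by move=> j; rewrite -ltnS ltn_neqAle cm cL.
have [i0 iyL] : exists i, (i, y) \in L by apply: cdeg_gt0; rewrite cy.
have yj0 : y != j0 by apply/eqP => yj; move: cj0; rewrite -yj cy ltnn.
have := LC _ iyL; rewrite !inE /= => /andP[yb yC].
have := LR _ iyL; rewrite !inE /= => /andP[ia iR].
(* A demand [(i0, y)] will slide along row [a] to [(i0, j2)]. The column [j0] is avoided because its
   cell in row [a] may be used already; more than three columns are available. *)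
have [j2] : exists j2, j2 \in C :\ b :\ y :\ j0.
  apply/card_gt0P; move: (cardsD1 j0 (C :\ b :\ y)) (cardsD1 y (C :\ b)).
  by rewrite (card_setD1_pred bC cC); nlia.
rewrite !inE => /and4P[j2j0 j2y j2b j2C].
have [L' E] := perm_cons_rem iyL.
apply: routable_perm (_ : perm_eq ((i0, y) :: L') L) _; first by rewrite perm_sym.
have F1 := Uj _ yb yj0; have F2 := Uj _ j2b j2j0.
apply: (@routable_col_shift _ _ _ _ _ _ a _ j2); rewrite /free /= ?aR ?yC ?j2C //.
have L'L : {subset L' <= L} by move=> p pL; rewrite (perm_mem E) !inE pL !orbT.
have rE k : rdeg L k = (i0 == k) + rdeg L' k by rewrite (perm_rdeg E) rdeg_cons.
have cE k : cdeg L k = (y == k) + cdeg L' k by rewrite (perm_cdeg E) cdeg_cons.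
apply: (@routable_shrink _ _ m _ (R :\ a) _ (C :\ b)) => //; rewrite ?subsetDl //.
  by move=> p; rewrite !in_cons => /or3P[/eqP->|/eqP->|/UP' //]; rewrite /= !inE eqxx.
split; try exact: card_setD1_pred.
- by move=> p; rewrite in_cons => /orP[/eqP->|/L'L/LR //]; rewrite !inE /= ia.
- by move=> p; rewrite in_cons => /orP[/eqP->|/L'L/LC //]; rewrite !inE /= j2b.
- by move: sL (perm_size E) => /=; nlia.
- by move=> k; have := rL k; rewrite rE.
(* Column [y] takes [m.+1] of at most [2 * m - 2] demands, so [j2] has room for one more. *)
move=> k; rewrite cdeg_cons /=; have := cL k; have := cE k.
have [<-|kj2] := eqVneq j2 k; first by have := cdeg_add_le L j2y; nlia.
have [<-|ky] := eqVneq y k; first by use_neq; nlia.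
by have := cdeg_add_le L ky; use_neq; nlia.
Qed.

Variable L : seq (A * B).
Hypothesis adm : admissible m.+1 R C L.
Hypothesis a0 : rdeg L a = 0.
Hypothesis b0 : 0 < cdeg L b.
Hypothesis b_simple : forall i, count_mem (i, b) L <= 1.

(** All demands [L1] of column [b] are served by their own edges, which are distinct since [b] has
    no repeated cell. It remains to dispose of two demands in total when [L] is large, and to lower
    the rows and columns of degree [m.+1]; columns are left to [routable_finish]. *)
Lemma routable_zero_row : routable R C [::] L.
Proof.
case: adm => _ _ LR LC sL rL cL.
pose L1 : seq (A * B) := [seq p <- L | p.2 == b].
pose L2 : seq (A * B) := [seq p <- L | p.2 != b].
have E : perm_eq (L1 ++ L2) L by exact: permEl (perm_filterC _ _).
have sE : size L = size L1 + size L2 by rewrite -(perm_size E) size_cat.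
have rE k : rdeg L k = rdeg L1 k + rdeg L2 k by rewrite -(perm_rdeg E) /rdeg count_cat.
have cE k : cdeg L k = cdeg L1 k + cdeg L2 k by rewrite -(perm_cdeg E) /cdeg count_cat.
have sL1 : size L1 = cdeg L b by rewrite size_filter.
have c2b : cdeg L2 b = 0.
  by apply/eqP; rewrite -leqn0 leqNgt -has_count has_filter -filter_predI;
     apply/negPn/eqP; rewrite -(filter_pred0 L); apply: eq_filter => p /=; case: eqP.
have L1P p : p \in L1 -> [/\ p.1 \in R, p.1 != a & p.2 = b].
  rewrite mem_filter => /andP[/eqP pb pL]; split=> //; first exact: LR.
  by apply: contraTneq (mem_rdeg pL) => ->; rewrite a0.
have L2P p : p \in L2 -> [/\ p.1 \in R :\ a, p.2 \in C :\ b & p \in L].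
  rewrite mem_filter => /andP[pb pL]; rewrite !inE pb LR ?LC // andbT.
  by split=> //; apply: contraTneq (mem_rdeg pL) => ->; rewrite a0.
have uL1 : uniq L1.
  apply: count_mem_uniq => p; case: (boolP (p \in L1)) => pL1; last exact: count_memPn.
  have := pL1; rewrite -has_pred1 has_count; have [_ _ pb] := L1P _ pL1.
  have: count_mem p L1 <= count_mem p L by rewrite -(permP E) count_cat leq_addr.
  by have := b_simple p.1; rewrite -{1}pb -surjective_pairing; nlia.
apply: routable_perm E _; apply: routable_edges => //.
  by move=> p /L1P[pR _ pb]; rewrite /free pR pb bC.
rewrite cats0.
have U1 : {in L1, forall p, (p.1 == a) || (p.2 == b)}.
  by move=> p /L1P[_ _ ->]; rewrite eqxx orbT.
have aL1 j : (a, j) \notin L1 by apply/negP => /L1P[_ /=]; rewrite eqxx.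
have c2 j : cdeg L2 j <= m.+1 by have := cL j; rewrite cE; nlia.
(* Either some nonempty row [i'] is missed by [L1], chosen to be the row of degree [m.+1] missed by
   [L1] if there is one, or every nonempty row loses a demand with [L1]. *)
have [[i' [ri' ri'0 rx]]|none] : (exists i', [/\ rdeg L1 i' = 0, 0 < rdeg L i'
      & forall x, rdeg L x = m.+1 -> 0 < rdeg L1 x \/ x = i']) \/
    (forall i, rdeg L1 i = 0 -> rdeg L i = 0).
  case: (pickP (fun x => (rdeg L x == m.+1) && (rdeg L1 x == 0))) => [x|noX].
    move=> /andP[/eqP rx /eqP r1x]; left; exists x; split=> //; first by rewrite rx.
    move=> z rz; case: (eqVneq z x) => [|/(rdeg_add_le L)]; first by right.
    by rewrite rx rz => H; have := leq_trans H sL; nlia.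
  case: (pickP (fun i => (rdeg L1 i == 0) && (0 < rdeg L i))) => [i|noI].
    move=> /andP[/eqP ri1 ri]; left; exists i; split=> // x rx; left.
    by have := noX x; rewrite rx eqxx /= lt0n => ->.
  by right=> i ri; have := noI i; rewrite ri eqxx /= lt0n => /negbFE/eqP.
- have [j' ijL2] : exists j', (i', j') \in L2.
    by apply: rdeg_gt0; move: (rE i'); nlia.
  have [] := L2P _ ijL2; rewrite !inE /= => /andP[i'a i'R] /andP[j'b j'C] _.
  have i'b : (i', b) \notin L1.
    by apply/negP => /mem_rdeg; rewrite ri'.
  have [L3 E3] := perm_cons_rem ijL2.
  apply: routable_perm (_ : perm_eq ((i', j') :: L3) L2) _; first by rewrite perm_sym.
  (* One further demand runs from row [i'] through column [b] and row [a] to column [j']. The only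
     edge of row [a] used outside column [b] is at [j'], whose degree has just dropped. *)
  apply: (@routable_path _ _ _ _ _ _ a _ b) => //;
    rewrite /free /= ?i'R ?aR ?bC ?j'C ?i'b ?aL1 //.
  have L32 : {subset L3 <= L2} by move=> p pL; rewrite (perm_mem E3) !inE pL !orbT.
  have r3 k : rdeg L2 k = (i' == k) + rdeg L3 k by rewrite (perm_rdeg E3) rdeg_cons.
  have c3 k : cdeg L2 k = (j' == k) + cdeg L3 k by rewrite (perm_cdeg E3) cdeg_cons.
  apply: (@routable_finish _ _ j').
  + move=> p; rewrite !in_cons => /or4P[/eqP->|/eqP->|/eqP->|/U1 //];
    by rewrite /= eqxx ?orbT.
  + by move=> p /L32/L2P[].
  + by move=> p /L32/L2P[].
  + by move: (perm_size E3) => /=; nlia.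
  + move=> k; have := rL k; rewrite leq_eqVlt => /orP[/eqP rk|].
      by case: (rx k rk) => [|ki]; have := rE k; have := r3 k;
        last rewrite ki eqxx -ki; nlia.
    by have := rE k; have := r3 k; nlia.
  + by move=> j; have := c2 j; rewrite c3; nlia.
  + by have := c2 j'; rewrite c3 eqxx; nlia.
  move=> j jb jj'; rewrite !in_cons !negb_or aL1 !xpair_eqE.
  by use_neq.
apply: (@routable_finish _ _ b) => //.
- by move=> p /L2P[].
- by move=> p /L2P[].
(* If [L1] is a single demand, its row is the only nonempty one, so there are at most [m.+1] demands
   in all. *)
- have [s1|s1] := leqP 2 (size L1); first by nlia.
  case def1: L1 s1 (sL1) => [|[i b'] [|? ?]] //= _ cb; first by nlia.
  have: rdeg L i = size L.
    apply/eqP; rewrite -all_count; apply/allP => p pL /=; apply/eqP.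
    have := mem_rdeg pL; case r1: (rdeg L1 p.1) => [|?]; first by rewrite none.
    by move: r1; rewrite def1 /rdeg /=; case: eqP => [->|].
  by have := rL i; rewrite sE def1 /=; nlia.
- move=> k; have := rE k; have := rL k; have := none k; nlia.
- by rewrite c2b.
Qed.

End ZeroRow.

(** * Deleting two rows and two columns *)

Lemma card_setD2 (T : finType) (S : {set T}) x y n :
  x \in S -> y \in S -> x != y -> #|S| = n.+2 -> #|S :\ x :\ y| = n.
Proof.
move=> xS yS xy cS; apply: card_setD1_pred; first by rewrite !inE eq_sym xy.
exact: card_setD1_pred.
Qed.

Lemma subsetD2 (T : finType) (S : {set T}) x y : S :\ x :\ y \subset S.
Proof. by rewrite (subset_trans (subsetDl _ _)) ?subsetDl. Qed.

Lemma perm_cons2 (A B : finType) (p : A * B) (L : seq (A * B)) :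
  1 < count_mem p L -> exists L' : seq (A * B), perm_eq L [:: p, p & L'].
Proof.
move=> c2; have /perm_cons_rem[L1 E1] : p \in L by rewrite -has_pred1 has_count ltnW.
have /perm_cons_rem[L2 E2] : p \in L1.
  by move: c2; rewrite (permP E1) /= eqxx -has_pred1 has_count.
by exists L2; rewrite (permPl E1) perm_cons.
Qed.

Lemma count_mem_le_rdeg (A B : finType) (L : seq (A * B)) i j :
  count_mem (i, j) L <= rdeg L i.
Proof. by apply: sub_count => p /eqP->; rewrite /= eqxx. Qed.

Lemma count_mem_le_cdeg (A B : finType) (L : seq (A * B)) i j :
  count_mem (i, j) L <= cdeg L j.
Proof. by apply: sub_count => p /eqP->; rewrite /= eqxx. Qed.

Lemma count_mem_swap (A B : eqType) (L : seq (A * B)) i j :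
  count_mem (j, i) (map swap L) = count_mem (i, j) L.
Proof.
by rewrite count_map; apply: eq_count => -[u v]; rewrite /= !xpair_eqE andbC.
Qed.

Lemma other_row (A B : finType) (L : seq (A * B)) i :
  rdeg L i < size L -> exists2 p, p \in L & p.1 != i.
Proof.
move=> ri; have /allPn[p pL pi] : ~~ all (fun p => p.1 == i) L.
  by rewrite all_count neq_ltn ri.
by exists p.
Qed.

Lemma other_col (A B : finType) (L : seq (A * B)) j :
  cdeg L j < size L -> exists2 p, p \in L & p.2 != j.
Proof.
move=> cj; have /allPn[p pL pj] : ~~ all (fun p => p.2 == j) L.
  by rewrite all_count neq_ltn cj.
by exists p.
Qed.

(** * Every nonempty line contains a repeated cell *)

Section Heavy.

Variables (A B : finType) (m : nat).
Hypothesis IH : all_routable m.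
Variables (R : {set A}) (C : {set B}) (L : seq (A * B)).
Hypothesis adm : admissible m.+2 R C L.
Hypothesis m_ge : 3 < m.
Hypothesis sizeL : size L = 2 * m + 2.
Hypothesis heavy_row : forall i, 0 < rdeg L i -> exists j, 1 < count_mem (i, j) L.
Hypothesis heavy_col : forall j, 0 < cdeg L j -> exists i, 1 < count_mem (i, j) L.

(** A repeated cell of row [x] and one of column [y] serve if they are in general position.
    Otherwise one takes a repeated cell in another row or column, which exists since a single line
    holds at most [m.+2] of the [2 * m + 2] demands. *)
Lemma heavy_pair x y : 0 < rdeg L x -> 0 < cdeg L y ->
  exists i j i' j', [/\ i != i', j != j',
    1 < count_mem (i, j) L /\ 1 < count_mem (i', j') L,
    x = i \/ x = i' & y = j \/ y = j'].
Proof.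
case: adm => _ _ _ _ _ rL cL.
move=> /heavy_row[j xj] /heavy_col[i iy].
case: (eqVneq j y) => [jy|jy]; last first.
  case: (eqVneq i x) => [ix|ix].
    have [p pL px] : exists2 p, p \in L & p.1 != x.
      by apply: other_row; have := rL x; rewrite sizeL; nlia.
    have [j' pj'] := heavy_row (mem_rdeg pL).
    have [j'y|j'y] := eqVneq j' y.
      exists x, j, p.1, j'; split=> //; [by rewrite eq_sym | by rewrite j'y | by left|by right].
    exists x, y, p.1, j'; split; [by rewrite eq_sym|by rewrite eq_sym| |by left|by left].
    by rewrite -ix.
  by exists x, j, i, y; split=> //; [rewrite eq_sym|left|right].
(* In the remaining case the cell [(x, y)] itself is repeated. *)
rewrite {}jy {j i iy} in xj.
have [p pL px] : exists2 p, p \in L & p.1 != x.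
  by apply: other_row; have := rL x; rewrite sizeL; nlia.
have [j' pj'] := heavy_row (mem_rdeg pL).
have [j'y|j'y] := eqVneq j' y; last first.
  by exists x, y, p.1, j'; split; [rewrite eq_sym|rewrite eq_sym| |left|left].
have [q qL qy] : exists2 q, q \in L & q.2 != y.
  by apply: other_col; have := cL y; rewrite sizeL; nlia.
have [i' qi'] := heavy_col (mem_cdeg qL).
have [i'x|i'x] := eqVneq i' x; last first.
  by exists x, y, i', q.2; split; [rewrite eq_sym|rewrite eq_sym| |left|left].
exists x, q.2, p.1, y; split; [by rewrite eq_sym|by []| |by left|by right].
by rewrite -{1}i'x -j'y.
Qed.

(* The two repeated demands, chosen in the fullest row and the fullest column,
   cross the 2 x 2 block of empty lines twice each. *)
Lemma routable_heavy_two a1 a2 b1 b2 :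
    a1 \in R -> a2 \in R -> a1 != a2 -> b1 \in C -> b2 \in C -> b1 != b2 ->
    rdeg L a1 = 0 -> rdeg L a2 = 0 -> cdeg L b1 = 0 -> cdeg L b2 = 0 ->
  routable R C [::] L.
Proof.
case: adm => cR cC LR LC _ rL cL a1R a2R a12 b1C b2C b12 ra1 ra2 cb1 cb2.
have [p0 p0L] : exists p, p \in L.
  by case: (L) sizeL => [|p s _]; [rewrite addn2|exists p; rewrite mem_head].
case: (@arg_maxnP _ p0.1 predT (rdeg L)) => // x _ xmax.
case: (@arg_maxnP _ p0.2 predT (cdeg L)) => // y _ ymax.
have x0 : 0 < rdeg L x by apply: leq_trans (mem_rdeg p0L) (xmax _ isT).
have y0 : 0 < cdeg L y by apply: leq_trans (mem_cdeg p0L) (ymax _ isT).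
have [i [j [i' [j' [ii' jj' [dij dij'] xi yj]]]]] := heavy_pair x0 y0.
have [L1 E1] := perm_cons2 dij.
have [L2 E2] : exists L2 : seq (A * B), perm_eq L1 [:: (i', j'), (i', j') & L2].
  by apply: perm_cons2; move: dij'; rewrite (permP E1) /= xpair_eqE; use_neq.
have E : perm_eq L [:: (i, j), (i, j), (i', j'), (i', j') & L2].
  by rewrite (permPl E1) !perm_cons.
have rE k : rdeg L k = (i == k) + ((i == k) + ((i' == k) + ((i' == k) + rdeg L2 k))).
  by rewrite (perm_rdeg E) !rdeg_cons.
have cE k : cdeg L k = (j == k) + ((j == k) + ((j' == k) + ((j' == k) + cdeg L2 k))).
  by rewrite (perm_cdeg E) !cdeg_cons.
have L2L : {subset L2 <= L} by move=> p pL; rewrite (perm_mem E) !inE pL !orbT.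
have ijL : (i, j) \in L by rewrite (perm_mem E) !inE eqxx.
have ijL' : (i', j') \in L by rewrite (perm_mem E) !inE eqxx !orbT.
have [[/= iR jC] [/= i'R j'C]] := ((LR _ ijL, LC _ ijL), (LR _ ijL', LC _ ijL')).
have ra p : p \in L -> p.1 != a1 /\ p.1 != a2.
  by move=> /mem_rdeg pL; split; apply: contraTneq pL => ->; rewrite ?ra1 ?ra2.
have cb p : p \in L -> p.2 != b1 /\ p.2 != b2.
  by move=> /mem_cdeg pL; split; apply: contraTneq pL => ->; rewrite ?cb1 ?cb2.
have [[/= n1 n2] [/= n3 n4]] := (ra _ ijL, ra _ ijL').
have [[/= n5 n6] [/= n7 n8]] := (cb _ ijL, cb _ ijL').
apply: routable_perm (_ : perm_eq [:: (i, j), (i, j), (i', j'), (i', j') & L2] L) _.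
  by rewrite perm_sym.
(* Each of the four paths crosses a different cell of the empty block: [(a1, b1)] and [(a2, b2)] for
   [(i, j)], then [(a2, b1)] and [(a1, b2)] for [(i', j')]. *)
apply: (@routable_path _ _ _ _ _ _ a1 _ b1); [by []|by free_cell..|].
apply: (@routable_path _ _ _ _ _ _ a2 _ b2); [by []|by free_cell..|].
apply: (@routable_path _ _ _ _ _ _ a2 _ b1); [by []|by free_cell..|].
apply: (@routable_path _ _ _ _ _ _ a1 _ b2); [by []|by free_cell..|].
apply: (@routable_shrink _ _ m _ (R :\ a1 :\ a2) _ (C :\ b1 :\ b2)) => //.
- exact: subsetD2.
- exact: subsetD2.
- by apply/allP; rewrite /= !inE; use_neq.
split.
- by apply: card_setD2 => //; rewrite eq_sym.
- by apply: card_setD2 => //; rewrite eq_sym.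
- by move=> p /L2L pL; have [n n'] := ra _ pL; rewrite !inE n n' LR.
- by move=> p /L2L pL; have [n n'] := cb _ pL; rewrite !inE n n' LC.
- by move: sizeL (perm_size E) => /= -> ; nlia.
(* Rows [i] and [i'] lose two demands each. One of them is the fullest row and the other has degree
   at least 2, so any third row satisfies [2 * rdeg L k + 2 <= 2 * m + 2]. *)
- move=> k; have := rL k; have := rE k.
  have [<-|ik] := eqVneq i k; first by nlia.
  have [<-|i'k] := eqVneq i' k; first by nlia.
  have := rdeg_add3_le L ii' ik i'k; rewrite sizeL.
  have := leq_trans dij (count_mem_le_rdeg _ _ _).
  have := leq_trans dij' (count_mem_le_rdeg _ _ _).
  by have := xmax k isT; case: xi => ->; rewrite /=; nlia.
move=> k; have := cL k; have := cE k.
have [<-|ik] := eqVneq j k; first by nlia.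
have [<-|i'k] := eqVneq j' k; first by nlia.
have := cdeg_add3_le L jj' ik i'k; rewrite sizeL.
have := leq_trans dij (count_mem_le_cdeg _ _ _).
have := leq_trans dij' (count_mem_le_cdeg _ _ _).
by have := ymax k isT; case: yj => ->; rewrite /=; nlia.
Qed.

Section OneZeroRow.

Variable a : A.
Hypotheses (aR : a \in R) (ra : rdeg L a = 0).
Hypothesis row_pos : {in R, forall i, i != a -> 0 < rdeg L i}.

(** The [m + 1] rows other than [a] each contain a repeated cell, hence at least two of the
    [2 * m + 2] demands. So each consists of exactly one doubled cell. *)
Lemma row_double i j : (i, j) \in L -> rdeg L i = 2 /\ count_mem (i, j) L = 2.
Proof.
case: adm => cR cC LR LC _ rL cL ijL.
have ge2 k : k \in R -> k != a -> 2 <= rdeg L k.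
  move=> kR ka; have [l kl] := heavy_row (row_pos kR ka).
  exact: leq_trans kl (count_mem_le_rdeg _ _ _).
have iR := LR _ ijL; rewrite /= in iR.
have ia : i != a by apply: contraTneq (mem_rdeg ijL) => /= ->; rewrite ra.
have r2 : rdeg L i = 2.
  apply/eqP; rewrite eqn_leq ge2 // andbT.
  have: \sum_(k in R :\ a :\ i) 2 <= \sum_(k in R :\ a :\ i) rdeg L k.
    by apply: leq_sum => k; rewrite !inE => /and3P[_ ka kR]; exact: ge2.
  have := sum_rdeg LR; rewrite (big_setD1 a) // (big_setD1 i) ?inE ?ia //=.
  rewrite sum_nat_const ra sizeL.
  have -> : #|R :\ a :\ i| = m by apply: card_setD2 => //; rewrite eq_sym.
  by nlia.
split=> //; have [j' dj'] := heavy_row (mem_rdeg ijL); rewrite /= in dj'.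
have [jj|jj] := eqVneq j' j.
  by apply/eqP; rewrite eqn_leq -{2}jj dj' andbT -r2 count_mem_le_rdeg.
have [L1 E1] := perm_cons2 dj'.
have: (i, j) \in L1.
  by move: ijL; rewrite (perm_mem E1) !inE !xpair_eqE; use_neq.
by move/mem_rdeg; move: r2; rewrite (perm_rdeg E1) !rdeg_cons /= eqxx; nlia.
Qed.

Lemma row_double_inj i j j' : (i, j) \in L -> (i, j') \in L -> j = j'.
Proof.
move=> ij ij'; have [r2 c2] := row_double ij.
have [L1 E1] : exists L1 : seq (A * B), perm_eq L [:: (i, j), (i, j) & L1].
  by apply: perm_cons2; rewrite c2.
move: ij'; rewrite (perm_mem E1) !inE !xpair_eqE eqxx /=.
case/or3P=> [/eqP-> //|/eqP-> //|/mem_rdeg].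
by move: r2; rewrite (perm_rdeg E1) !rdeg_cons /= eqxx; nlia.
Qed.

(* The row [r] is deleted with [a]: of its two demands one is served directly
   and one through [a], which frees [r] to serve another demand. *)
Lemma routable_heavy_one_two b1 b2 :
    b1 \in C -> b2 \in C -> b1 != b2 -> cdeg L b1 = 0 -> cdeg L b2 = 0 ->
  routable R C [::] L.
Proof.
case: adm => cR cC LR LC _ rL cL b1C b2C b12 cb1 cb2.
have [p0 p0L] : exists p, p \in L.
  by case: (L) sizeL => [|p s _]; [rewrite addn2|exists p; rewrite mem_head].
case: (@arg_maxnP _ p0.2 predT (cdeg L)) => // c _ cmax.
have [r rcL] : exists r, (r, c) \in L.
  by apply: cdeg_gt0; apply: leq_trans (mem_cdeg p0L) (cmax _ isT).
have [q qL qc] : exists2 q, q \in L & q.2 != c.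
  by apply: other_col; have := cL c; rewrite sizeL; nlia.
(* Columns [c] and [j] are the two fullest ones; they are the ones that may exceed [m]. *)
case: (@arg_maxnP _ q.2 (fun k => k != c) (cdeg L)) => // j jc jmax.
have [i ijL] : exists i, (i, j) \in L.
  by apply: cdeg_gt0; apply: leq_trans (mem_cdeg qL) (jmax _ qc).
(* Column [c] and row [i] together hold at most [m + 4] demands, fewer than [2 * m + 2]. *)
have [[i2 j2] i2L] : exists2 p, p \in L & ~~ ((p.2 == c) || (p.1 == i)).
  have /allPn[p] : ~~ all (fun p => (p.2 == c) || (p.1 == i)) L; last by exists p.
  rewrite all_count neq_ltn; apply/orP; left.
  have: count (fun p => (p.2 == c) || (p.1 == i)) L <= cdeg L c + rdeg L i.
    by rewrite -count_predUI leq_addr.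
  by have := cL c; have [-> _] := row_double ijL; rewrite sizeL; nlia.
rewrite negb_or /= => /andP[j2c i2i].
have ir : i != r.
  by apply: contraNneq jc => ir; rewrite ir in ijL; rewrite (row_double_inj ijL rcL).
have i2r : i2 != r.
  by apply: contraNneq j2c => e; rewrite e in i2L; rewrite (row_double_inj i2L rcL).
have [r2 drc] := row_double rcL.
have [L1 E1] : exists L1 : seq (A * B), perm_eq L [:: (r, c), (r, c) & L1].
  by apply: perm_cons2; rewrite drc.
have /perm_cons_rem[L2 E2] : (i, j) \in L1.
  by move: ijL; rewrite (perm_mem E1) !inE !xpair_eqE; use_neq.
have /perm_cons_rem[L3 E3] : (i2, j2) \in L2.
  by move: i2L; rewrite (perm_mem E1) !inE (perm_mem E2) !inE !xpair_eqE; use_neq.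
have E : perm_eq L [:: (r, c), (r, c), (i, j), (i2, j2) & L3].
  by rewrite (permPl E1) !perm_cons (permPl E2) perm_cons.
have rE k : rdeg L k = (r == k) + ((r == k) + ((i == k) + ((i2 == k) + rdeg L3 k))).
  by rewrite (perm_rdeg E) !rdeg_cons.
have cE k : cdeg L k = (c == k) + ((c == k) + ((j == k) + ((j2 == k) + cdeg L3 k))).
  by rewrite (perm_cdeg E) !cdeg_cons.
have L3L : {subset L3 <= L} by move=> p pL; rewrite (perm_mem E) !inE pL !orbT.
have [/= rR cC'] := (LR _ rcL, LC _ rcL).
have [/= iR jC] := (LR _ ijL, LC _ ijL).
have [/= i2R j2C] := (LR _ i2L, LC _ i2L).
have na p : p \in L -> p.1 != a.
  by move=> /mem_rdeg pL; apply: contraTneq pL => ->; rewrite ra.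
have cb p : p \in L -> p.2 != b1 /\ p.2 != b2.
  by move=> /mem_cdeg pL; split; apply: contraTneq pL => ->; rewrite ?cb1 ?cb2.
have [/= n1 [/= n2 n3]] := (na _ rcL, cb _ rcL).
have [/= n4 [/= n5 n6]] := (na _ ijL, cb _ ijL).
have [/= n7 [/= n8 n9]] := (na _ i2L, cb _ i2L).
apply: routable_perm (_ : perm_eq [:: (r, c), (r, c), (i, j), (i2, j2) & L3] L) _.
  by rewrite perm_sym.
(* The second copy of [(r, c)] goes through [b1] and [a], then [(i, j)] through [b2] and [r], and
   [(i2, j2)] through [b2] and [a]. *)
apply: routable_edge; first by free_cell.
apply: (@routable_path _ _ _ _ _ _ a _ b1); [by []|by free_cell..|].
apply: (@routable_path _ _ _ _ _ _ r _ b2); [by []|by free_cell..|].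
apply: (@routable_path _ _ _ _ _ _ a _ b2); [by []|by free_cell..|].
apply: (@routable_shrink _ _ m _ (R :\ a :\ r) _ (C :\ b1 :\ b2)) => //.
- exact: subsetD2.
- exact: subsetD2.
- by apply/allP; rewrite /= !inE; use_neq.
split.
- by apply: card_setD2 => //; rewrite eq_sym.
- by apply: card_setD2 => //; rewrite eq_sym.
- move=> p pL; rewrite !inE na ?L3L // LR ?L3L // !andbT; apply/eqP => pr.
  by move: r2 (mem_rdeg pL); rewrite pr rE eqxx {pr}; nlia.
- by move=> p /L3L pL; have [n n'] := cb _ pL; rewrite !inE n n' LC.
- by move: sizeL (perm_size E) => /= -> ; nlia.
- move=> k; have [/eqP r0|r0] := boolP (rdeg L k == 0); first by have := rE k; nlia.
  have [l kl] : exists l, (k, l) \in L by apply: rdeg_gt0; rewrite lt0n.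
  by have [] := row_double kl; have := rE k; nlia.
(* Column [c] loses two demands. Column [j] has degree at most [m + 1], being no fuller than [c],
   and loses one. Any other column holds at most a third of the demands. *)
move=> k; have := cL k; have := cE k.
have [<-|ck] := eqVneq c k; first by nlia.
have := cmax j isT; rewrite /= => jle.
have [<-|jk] := eqVneq j k.
  by have := cdeg_add_le L jc; rewrite sizeL; nlia.
have cj : c != j by rewrite eq_sym.
have kc : k != c by rewrite eq_sym.
have := cdeg_add3_le L cj ck jk; rewrite sizeL.
by have := jmax k kc; rewrite /=; nlia.
Qed.

End OneZeroRow.

End Heavy.

Section OneOne.

Variables (A B : finType) (m : nat).
Hypothesis IH : all_routable m.
Variables (R : {set A}) (C : {set B}) (L : seq (A * B)).
Hypothesis adm : admissible m.+2 R C L.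
Hypothesis m_ge : 3 < m.
Hypothesis sizeL : size L = 2 * m + 2.
Hypothesis heavy_row : forall i, 0 < rdeg L i -> exists j, 1 < count_mem (i, j) L.
Hypothesis heavy_col : forall j, 0 < cdeg L j -> exists i, 1 < count_mem (i, j) L.

(* All demands come in pairs, which form a partial transversal of the grid. *)
Lemma routable_heavy_one_one a b :
    a \in R -> b \in C -> rdeg L a = 0 -> cdeg L b = 0 ->
    {in R, forall i, i != a -> 0 < rdeg L i} ->
    {in C, forall j, j != b -> 0 < cdeg L j} ->
  routable R C [::] L.
Proof.
case: adm => cR cC LR LC _ rL cL aR bC ra cb rpos cpos.
have rd i j : (i, j) \in L -> rdeg L i = 2 /\ count_mem (i, j) L = 2.
  exact: (row_double adm m_ge sizeL heavy_row aR ra rpos).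
have rinj i j j' : (i, j) \in L -> (i, j') \in L -> j = j'.
  exact: (row_double_inj adm m_ge sizeL heavy_row aR ra rpos).
(* The transposed grid also has exactly one empty row, so columns consist of doubled cells as
   well. *)
have cd i j : (i, j) \in L -> cdeg L j = 2.
  move=> ijL; rewrite -rdeg_swap.
  have sw : (j, i) \in map swap L by apply/mapP; exists (i, j).
  apply: (proj1 (@row_double _ _ m _ _ _ (admissible_swap adm) m_ge
    _ _ b bC _ _ _ _ sw)).
  - by rewrite size_map.
  - by move=> k; rewrite rdeg_swap => /heavy_col[l kl]; exists l; rewrite count_mem_swap.
  - by rewrite rdeg_swap cb.
  - by move=> k kC kb; rewrite rdeg_swap cpos.
have [r] : exists r, r \in R :\ a.
  by apply/card_gt0P; rewrite (card_setD1_pred aR cR).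
rewrite !inE => /andP[ra' rR].
have [c rcL] := rdeg_gt0 (rpos _ rR ra').
have := LC _ rcL; rewrite /= => cC'.
have nb p : p \in L -> p.2 != b.
  by move=> /mem_cdeg pL; apply: contraTneq pL => ->; rewrite cb.
have na p : p \in L -> p.1 != a.
  by move=> /mem_rdeg pL; apply: contraTneq pL => ->; rewrite ra.
have := nb _ rcL; rewrite /= => cb'.
have cCbc : #|C :\ b :\ c| = m by apply: card_setD2 => //; rewrite eq_sym.
have [d] : exists d, d \in C :\ b :\ c by apply/card_gt0P; rewrite cCbc; nlia.
rewrite !inE => /and3P[dc db dC].
have [s sdL] := cdeg_gt0 (cpos _ dC db).
have := LR _ sdL; rewrite /= => sR; have := na _ sdL; rewrite /= => sa.
have sr : s != r.
  by apply: contraNneq dc => sr; rewrite sr in sdL; rewrite (rinj _ _ _ sdL rcL).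
have [e] : exists e, e \in C :\ b :\ c :\ d.
  by apply/card_gt0P; move: (cardsD1 d (C :\ b :\ c)); rewrite cCbc; nlia.
rewrite !inE => /and4P[ed ec eb eC].
have [t] : exists t, t \in R :\ a :\ r :\ s.
  apply/card_gt0P; move: (cardsD1 s (R :\ a :\ r)).
  have -> : #|R :\ a :\ r| = m by apply: card_setD2 => //; rewrite eq_sym.
  by nlia.
rewrite !inE => /and4P[ts tr ta tR].
have [r2 drc] := rd _ _ rcL; have [s2 dsd] := rd _ _ sdL; have cd2 := cd _ _ sdL.
have [L1 E1] : exists L1 : seq (A * B), perm_eq L [:: (r, c), (r, c) & L1].
  by apply: perm_cons2; rewrite drc.
have [L2 E2] : exists L2 : seq (A * B), perm_eq L1 [:: (s, d), (s, d) & L2].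
  apply: perm_cons2; move: dsd; rewrite (permP E1) /= !xpair_eqE; use_neq.
  by rewrite !add0n => ->.
have E : perm_eq L [:: (r, c), (r, c), (s, d), (s, d) & L2].
  by rewrite (permPl E1) !perm_cons.
have rE k : rdeg L k = (r == k) + ((r == k) + ((s == k) + ((s == k) + rdeg L2 k))).
  by rewrite (perm_rdeg E) !rdeg_cons.
have cE k : cdeg L k = (c == k) + ((c == k) + ((d == k) + ((d == k) + cdeg L2 k))).
  by rewrite (perm_cdeg E) !cdeg_cons.
have L2L : {subset L2 <= L} by move=> p pL; rewrite (perm_mem E) !inE pL !orbT.
apply: routable_perm (_ : perm_eq [:: (r, c), (r, c), (s, d), (s, d) & L2] L) _.
  by rewrite perm_sym.
(* The two copies of [(r, c)] use only cells of rows [r] and [a], with a detour through column [e];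
   those of [(s, d)] use only cells of columns [d] and [b], with a detour through row [t]. Hence
   rows [a], [r] and columns [b], [d] can be deleted. *)
apply: routable_edge; first by free_cell.
apply: (@routable_path _ _ _ _ _ _ a _ e); [by rewrite eq_sym|by free_cell..|].
apply: routable_edge; first by free_cell.
apply: (@routable_path _ _ _ _ _ _ t _ b); [by []|by free_cell..|].
apply: (@routable_shrink _ _ m _ (R :\ a :\ r) _ (C :\ b :\ d)) => //.
- exact: subsetD2.
- exact: subsetD2.
- by apply/allP; rewrite /= !inE; use_neq.
split.
- by apply: card_setD2 => //; rewrite eq_sym.
- by apply: card_setD2 => //; rewrite eq_sym.
- move=> p pL; rewrite !inE na ?L2L // LR ?L2L // !andbT; apply/eqP => pr.
  by move: r2 (mem_rdeg pL); rewrite pr rE eqxx {pr}; nlia.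
- move=> p pL; rewrite !inE nb ?L2L // LC ?L2L // !andbT; apply/eqP => pr.
  by move: cd2 (mem_cdeg pL); rewrite pr cE eqxx {pr}; nlia.
- by move: sizeL (perm_size E) => /= -> ; nlia.
- move=> k; have [/eqP r0|r0] := boolP (rdeg L k == 0); first by have := rE k; nlia.
  have [l kl] : exists l, (k, l) \in L by apply: rdeg_gt0; rewrite lt0n.
  by have [] := rd _ _ kl; have := rE k; nlia.
move=> k; have [/eqP r0|r0] := boolP (cdeg L k == 0); first by have := cE k; nlia.
have [l kl] : exists l, (l, k) \in L by apply: cdeg_gt0; rewrite lt0n.
by have := cd _ _ kl; have := cE k; nlia.
Qed.

End OneOne.

(** * Small grids *)

(* [has] and the boolean connectives are strict under [vm_compute]. *)
Fixpoint exists_if (T : Type) (a : pred T) (s : seq T) : bool :=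
  if s is x :: s' then if a x then true else exists_if a s' else false.

Lemma exists_ifE (T : Type) (a : pred T) (s : seq T) : exists_if a s = has a s.
Proof. by elim: s => //= x s ->; case: (a x). Qed.

(* Under [strict] the paths have length at most 3. Longer ones are needed in
   K_{4,4} for two cells in general position of multiplicities 4 and 2. *)
Fixpoint search (strict : bool) n fuel (U L : seq (nat * nat)) : bool :=
  if L is (i, j) :: L' then
    if fuel is f.+1 then
      if (i, j) \notin U then search strict n f ((i, j) :: U) L'
      else exists_if (fun i' =>
        if strict && ((i', j) \in U) then false else
        exists_if (fun j' =>
          if (i, j') \in U then false else
          if (i', j') \in U then false else
          search strict n f [:: (i, j'), (i', j') & U] ((i', j) :: L'))
        (rev (iota 0 n))) (rev (iota 0 n))
    else false
  else true.

Definition cells n : seq (nat * nat) := [seq (k, l) | k <- iota 0 n, l <- iota 0 n].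

Definition entry (M : seq (seq nat)) (p : nat * nat) := nth 0 (nth [::] M p.1) p.2.

Definition spread (T : Type) (e : T -> nat) (s : seq T) :=
  flatten [seq nseq (e p) p | p <- s].

(** One copy of each demanded cell comes first, so that the search gives every such cell its own
    edge before it looks for detours. *)
Definition demands n M :=
  [seq p <- cells n | 0 < entry M p] ++ spread (fun p => (entry M p).-1) (cells n).

Fixpoint vecs w s : seq (seq nat) :=
  if w is w'.+1 then
    flatten [seq [seq x :: v | v <- vecs w' (s - x)] | x <- iota 0 s.+1]
  else [:: [::]].

(** The bound [d] for the next row is the sum of the current one, so that only matrices with
    nonincreasing row sums and total [s] are listed. *)
Fixpoint mats (good : pred (seq nat)) n h s d : seq (seq (seq nat)) :=
  if h is h'.+1 then
    flatten [seq [seq v :: M | M <- mats good n h' (s - sumn v) (sumn v)]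
            | v <- [seq v <- vecs n (minn s d) | good v]]
  else if s == 0 then [:: [::]] else [::].

Definition column (M : seq (seq nat)) l := [seq nth 0 v l | v <- M].

(** Matrices whose columns are not good or not sorted by sum pass vacuously. The fuel allows one
    slide and one edge per demand; running out of it can only make the search fail. *)
Definition check_mat good n M :=
  let cols := [seq column M l | l <- iota 0 n] in
  if all good cols && path geq n [seq sumn v | v <- cols] then
    let L := demands n M in
    let fuel := 2 * size L in
    if search true n fuel [::] L then true else search false n fuel [::] L
  else true.

Definition check good n := all (check_mat good n) (mats good n n (2 * n - 2) n).

(** The line is empty or contains a repeated cell. *)
Definition heavy (v : seq nat) := (sumn v == 0) || has (leq 2) v.

Lemma check4 : check xpredT 4.
Proof. by vm_compute. Qed.

Lemma check5 : check heavy 5.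
Proof. by vm_compute. Qed.

Lemma mem_vecs v s : sumn v <= s -> v \in vecs (size v) s.
Proof.
elim: v s => [|x v IH] s // vs; rewrite /= in vs.
rewrite -[vecs _ _]/(flatten [seq [seq y :: w | w <- vecs (size v) (s - y)]
  | y <- iota 0 s.+1]).
apply/flatten_mapP; exists x.
  by rewrite mem_iota; lia.
by apply: map_f; apply: IH; lia.
Qed.

Lemma mem_mats good n s d (M : seq (seq nat)) :
    all (fun v => size v == n) M -> all good M -> path geq d (map sumn M) ->
    sumn (map sumn M) = s ->
  M \in mats good n (size M) s d.
Proof.
elim: M s d => [|v M IH] s d /= => [_ _ _ <- //|].
case/andP=> /eqP sv sM /andP[gv gM] /andP[vd dM] Es.
apply/flatten_mapP; exists v; last by apply: map_f; apply: IH => //; lia.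
by rewrite mem_filter gv -{1}sv mem_vecs //; move: vd; rewrite /=; lia.
Qed.

Section Search.

Variables (A B : finType) (R : {set A}) (C : {set B}) (n : nat).
Variables (f : nat -> A) (g : nat -> B).
Hypothesis f_inj : {in gtn n &, injective f}.
Hypothesis g_inj : {in gtn n &, injective g}.
Hypothesis fR : {in gtn n, forall k, f k \in R}.
Hypothesis gC : {in gtn n, forall k, g k \in C}.

Definition relabel (p : nat * nat) := (f p.1, g p.2).

Definition below (p : nat * nat) := (p.1 < n) && (p.2 < n).

Lemma relabel_inj : {in below &, injective relabel}.
Proof.
move=> [i j] [i' j'] /andP[/= ? ?] /andP[/= ? ?] [Ef Eg].
by rewrite (f_inj _ _ Ef) // (g_inj _ _ Eg).
Qed.

Lemma free_relabel U p : all below U -> below p -> p \notin U ->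
  free R C (map relabel U) (relabel p).
Proof.
move=> /allP bU bp pU; have /andP[p1 p2] := bp.
rewrite /free /= fR // gC //=; apply: contra pU => /mapP[q qU Epq].
by rewrite (relabel_inj bp (bU _ qU) Epq).
Qed.

(** Soundness only: a successful branch is a sequence of applications of [routable_edge] and
    [routable_row_shift], carried over to the lines named by [f] and [g]. *)
Lemma search_routable strict fuel U L : all below U -> all below L ->
  search strict n fuel U L -> routable R C (map relabel U) (map relabel L).
Proof.
elim: fuel U L => [|fuel IH] U [|[i j] L] //=; try by move=> *; apply: routable_nil.
move=> bU /andP[bij bL]; have /andP[/= ni nj] := bij.
case: ifP => [ijU /IH S|_].
  apply: routable_edge; first exact: (@free_relabel _ (i, j)).
  by apply: S => //=; rewrite bij.
rewrite exists_ifE => /hasP[i']; rewrite mem_rev mem_iota /= add0n => ni'.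
case: ifP => // _; rewrite exists_ifE => /hasP[j'].
rewrite mem_rev mem_iota /= add0n => nj'.
case: ifP => // /negbT U1; case: ifP => // /negbT U2 /IH S.
have b1 : below (i, j') by rewrite /below /= ni.
have b2 : below (i', j') by rewrite /below /= ni'.
apply: (@routable_row_shift _ _ _ _ _ _ (f i') _ (g j')).
- exact: (@free_relabel _ (i, j')).
- exact: (@free_relabel _ (i', j')).
by apply: S; rewrite /= ?b1 ?b2 // /below /= ni' nj.
Qed.

End Search.

Lemma perm_spread (T : eqType) (e : T -> nat) s :
  perm_eq ([seq p <- s | 0 < e p] ++ spread (fun p => (e p).-1) s) (spread e s).
Proof.
apply/permP => a; rewrite count_cat /spread; elim: s => //= p s IH.
rewrite !count_cat !count_nseq -IH; case: (e p) => [|k] /=; lia.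
Qed.

Lemma perm_spread_count (T : eqType) (s L : seq T) :
  uniq s -> {subset L <= s} -> perm_eq (spread (fun p => count_mem p L) s) L.
Proof.
move=> us sL; apply/allP => p _ /=; apply/eqP.
rewrite /spread count_flatten -map_comp sumnE big_map.
rewrite (eq_bigr (fun q => (q == p) * count_mem p L)) => [|q _]; last first.
  by rewrite /= count_nseq /=; case: eqP => [->|]; rewrite ?mul1n.
rewrite -big_distrl /=.
have -> : \sum_(q <- s) (q == p) = count_mem p s.
  by rewrite -sumn_count sumnE big_map.
rewrite count_uniq_mem //; case: (boolP (p \in s)) => [_|ps]; first by rewrite mul1n.
by symmetry; rewrite mul0n; apply/count_memPn; apply: contra ps => /sL.
Qed.

Lemma sum_count_key (T S : eqType) (key : T -> S) (s : seq S) (L : seq T) :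
  uniq s -> {in L, forall p, key p \in s} ->
  sumn [seq count (fun p => key p == x) L | x <- s] = size L.
Proof.
move=> us Ls; rewrite sumnE big_map.
elim: L Ls => [|p L IH] Ls /=; first by rewrite big1.
rewrite big_split /= IH => [|q qL]; last by rewrite Ls // in_cons qL orbT.
have -> : \sum_(x <- s) (key p == x) = count_mem (key p) s.
  by rewrite -sumn_count sumnE big_map; apply: eq_bigr => x _; rewrite eq_sym.
by rewrite count_uniq_mem // Ls ?mem_head.
Qed.

Lemma sum_row (A B : eqType) (sC : seq B) (L : seq (A * B)) i :
  uniq sC -> {in L, forall p, p.2 \in sC} ->
  sumn [seq count_mem (i, j) L | j <- sC] = rdeg L i.
Proof.
move=> uC LC; rewrite /rdeg -size_filter.
rewrite -(@sum_count_key _ _ snd sC _ uC) => [|p]; last first.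
  by rewrite mem_filter => /andP[_ /LC].
congr sumn; apply: eq_map => j; rewrite count_filter.
by apply: eq_count => -[u v] /=; rewrite xpair_eqE andbC.
Qed.

Lemma sum_col (A B : eqType) (sR : seq A) (L : seq (A * B)) j :
  uniq sR -> {in L, forall p, p.1 \in sR} ->
  sumn [seq count_mem (i, j) L | i <- sR] = cdeg L j.
Proof.
move=> uR LR; rewrite -rdeg_swap -(@sum_row _ _ sR) //.
  by congr sumn; apply: eq_map => i; rewrite count_mem_swap.
by move=> _ /mapP[p /LR ? ->].
Qed.

(** The matrix [M] of multiplicities, with lines in the sorted orders [sR] and [sC], is among those
    enumerated; a successful search for it is relabelled to a routing of [L]. *)
Lemma routable_check (A B : finType) good n (sR : seq A) (sC : seq B)
    (L : seq (A * B)) :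
    check good n -> uniq sR -> uniq sC -> size sR = n -> size sC = n ->
    {in L, forall p, p.1 \in sR} -> {in L, forall p, p.2 \in sC} ->
    size L = 2 * n - 2 ->
    path geq n (map (rdeg L) sR) -> path geq n (map (cdeg L) sC) ->
    (forall i, good [seq count_mem (i, j) L | j <- sC]) ->
    (forall j, good [seq count_mem (i, j) L | i <- sR]) ->
  routable [set i in sR] [set j in sC] [::] L.
Proof.
move=> /allP chk uR uC zR zC LR LC zL pR pC goodR goodC.
(* A first demand supplies the default row [a0] and column [b0] for [nth]. *)
case: L => [|[a0 b0] L0] in LR LC zL pR pC goodR goodC *; first exact: routable_nil.
set L := _ :: L0 in LR LC zL pR pC goodR goodC *.
pose M := [seq [seq count_mem (i, j) L | j <- sC] | i <- sR].
have sumM : map sumn M = map (rdeg L) sR.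
  by rewrite -map_comp; apply: eq_map => i; apply: sum_row.
have Mn : M \in mats good n n (2 * n - 2) n.
  rewrite -{2}zR -(size_map (fun i => [seq count_mem (i, j) L | j <- sC]) sR).
  apply: mem_mats; rewrite ?sumM //.
  - by apply/allP => _ /mapP[i _ ->]; rewrite size_map zC.
  - by apply/allP => _ /mapP[i _ ->].
  by rewrite -zL -(@sum_count_key _ _ fst sR L uR LR).
have colM : [seq column M l | l <- iota 0 n] =
    [seq [seq count_mem (i, j) L | i <- sR] | j <- sC].
  rewrite -[sC in RHS](mkseq_nth b0) zC /mkseq -map_comp.
  apply/eq_in_map => l; rewrite mem_iota /= => ln.
  rewrite /column -map_comp; apply: eq_map => i /=.
  by rewrite (nth_map b0) ?zC.
have := chk _ Mn; rewrite /check_mat colM ifT; last first.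
  apply/andP; split; first by apply/allP => _ /mapP[j _ ->].
  by rewrite -map_comp (eq_map (_ : _ =1 cdeg L)) // => j; apply: sum_col.
pose f k := nth a0 sR k; pose g k := nth b0 sC k.
have f_inj : {in gtn n &, injective f}.
  by move=> k l kn ln /eqP; rewrite nth_uniq ?zR // => /eqP.
have g_inj : {in gtn n &, injective g}.
  by move=> k l kn ln /eqP; rewrite nth_uniq ?zC // => /eqP.
have fR : {in gtn n, forall k, f k \in [set i in sR]}.
  by move=> k kn; rewrite inE mem_nth ?zR.
have gC : {in gtn n, forall k, g k \in [set j in sC]}.
  by move=> k kn; rewrite inE mem_nth ?zC.
have cellsP p : p \in cells n -> below n p.
  by case/allpairsP=> [[k l] [/= + + ->]]; rewrite !mem_iota /below /= => -> ->.
have relabel_cells : map (relabel f g) (cells n) = [seq (i, j) | i <- sR, j <- sC].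
  rewrite -[sR in RHS](mkseq_nth a0) -[sC in RHS](mkseq_nth b0) zR zC /mkseq.
  by rewrite /cells map_allpairs allpairs_mapl allpairs_mapr.
have dem : perm_eq (map (relabel f g) (demands n M)) L.
  apply: perm_trans (perm_map _ (perm_spread (entry M) (cells n))) _.
  have -> : map (relabel f g) (spread (entry M) (cells n)) =
      spread (fun p => count_mem p L) (map (relabel f g) (cells n)).
    rewrite /spread map_flatten -!map_comp; congr flatten.
    apply/eq_in_map => p /cellsP/andP[p1 p2] /=; rewrite map_nseq; congr nseq.
    by rewrite /entry (nth_map a0) ?zR // (nth_map b0) ?zC.
  apply: perm_spread_count; rewrite relabel_cells.
    by apply: allpairs_uniq => // -[? ?] [? ?].
  by move=> p pL; apply/allpairsP; exists p; rewrite LR ?LC //; case: p pL.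
have below_dem : all (below n) (demands n M).
  rewrite all_cat; apply/andP; split; apply/allP => p.
    by rewrite mem_filter => /andP[_ /cellsP].
  by case/flatten_mapP=> q /cellsP qn; rewrite mem_nseq => /andP[_ /eqP->].
move=> srch; apply: routable_perm dem _.
suff [strict S] : exists strict,
    search strict n (2 * size (demands n M)) [::] (demands n M).
  exact: (search_routable f_inj g_inj fR gC _ below_dem S).
by move: srch; case: ifP => [? _|_ ?]; [exists true|exists false].
Qed.

(** * The induction *)

(** Rows and columns are sorted by decreasing degree. Since that order is fixed only in the proof,
    goodness is asked for every duplicate-free listing of the lines. *)
Lemma admissible_check (A B : finType) good n (R : {set A}) (C : {set B})
    (L : seq (A * B)) :
    check good n -> admissible n R C L -> size L = 2 * n - 2 ->
    (forall i s, uniq s -> {in C, forall j, j \in s} ->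
      good [seq count_mem (i, j) L | j <- s]) ->
    (forall j s, uniq s -> {in R, forall i, i \in s} ->
      good [seq count_mem (i, j) L | i <- s]) ->
  routable R C [::] L.
Proof.
move=> chk [cR cC LR LC _ rL cL] sL goodR goodC.
pose sR := sort (relpre (rdeg L) geq) (enum R).
pose sC := sort (relpre (cdeg L) geq) (enum C).
have geq_total : total geq by move=> x y /=; exact: leq_total.
have geq_trans : transitive geq by move=> y x z /= xy yz; exact: leq_trans yz xy.
have mR i : (i \in sR) = (i \in R) by rewrite mem_sort mem_enum.
have mC j : (j \in sC) = (j \in C) by rewrite mem_sort mem_enum.
have -> : R = [set i in sR] by apply/setP => i; rewrite inE mR.
have -> : C = [set j in sC] by apply/setP => j; rewrite inE mC.
have uR : uniq sR by rewrite sort_uniq enum_uniq.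
have uC : uniq sC by rewrite sort_uniq enum_uniq.
apply: (routable_check chk uR uC _ _ _ _ sL).
- by rewrite size_sort -cardE.
- by rewrite size_sort -cardE.
- by move=> p /LR; rewrite mR.
- by move=> p /LC; rewrite mC.
- rewrite path_sortedE // sorted_map sort_sorted; last by move=> x y; apply: geq_total.
  by rewrite andbT; apply/allP => _ /mapP[i _ ->]; apply: rL.
- rewrite path_sortedE // sorted_map sort_sorted; last by move=> x y; apply: geq_total.
  by rewrite andbT; apply/allP => _ /mapP[i _ ->]; apply: cL.
- by move=> i; apply: (goodR i sC uC) => j; rewrite mC.
- by move=> j; apply: (goodC j sR uR) => i; rewrite mR.
Qed.

(** If no nonempty column is free of repeated cells, then no column has degree 1, and by [many_deg1]
    some column is empty. *)
Lemma zero_row_step (A B : finType) m (R : {set A}) (C : {set B})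
    (L : seq (A * B)) a :
    all_routable m -> 3 < m -> admissible m.+1 R C L -> a \in R -> rdeg L a = 0 ->
  routable R C [::] L \/ (exists2 b, b \in C & cdeg L b = 0) /\
    (forall j, 0 < cdeg L j -> exists i, 1 < count_mem (i, j) L).
Proof.
move=> IH m_ge adm aR a0; have [cR cC LR LC sL _ _] := adm.
pose simple j := (0 < cdeg L j) && [forall i, count_mem (i, j) L <= 1].
case: (pickP simple) => [b /andP[b0 /forallP b1]|none].
  have [i ibL] := cdeg_gt0 b0; left.
  exact: (routable_zero_row IH m_ge cR cC aR (LC _ ibL) adm a0).
right; split.
  case: (pickP (fun b => (b \in C) && (cdeg L b == 0))) => [b /andP[bC /eqP b0]|pos].
    by exists b.
  have : 0 < #|[set j in C | rdeg (map swap L) j == 1]|.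
    apply/ltnW/many_deg1; rewrite ?size_map ?cC //.
      by move=> _ /mapP[p /LC ? ->].
    by move=> j jC; rewrite rdeg_swap; have := pos j; rewrite jC lt0n /= => ->.
  case/card_gt0P=> j; rewrite inE rdeg_swap => /andP[_ /eqP j1].
  have := none j; rewrite /simple j1 /= => /negbT/negP[].
  by apply/forallP => i; rewrite -j1 count_mem_le_cdeg.
move=> j j0; have := none j; rewrite /simple j0 /= => /negbT.
by rewrite negb_forall => /existsP[i]; rewrite -ltnNge; exists i.
Qed.

Lemma routable_heavy (A B : finType) m (R : {set A}) (C : {set B})
    (L : seq (A * B)) a b :
    (3 < m -> all_routable m) -> 2 < m -> admissible m.+2 R C L ->
    size L = 2 * m + 2 ->
    (forall i, 0 < rdeg L i -> exists j, 1 < count_mem (i, j) L) ->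
    (forall j, 0 < cdeg L j -> exists i, 1 < count_mem (i, j) L) ->
    a \in R -> rdeg L a = 0 -> b \in C -> cdeg L b = 0 ->
  routable R C [::] L.
Proof.
move=> IH m_ge adm sL hr hc aR a0 bC b0; have [cR cC LR LC _ _ _] := adm.
(* For [m = 3] the grid is 5 by 5, and deleting two rows and two columns would leave the range of
   the induction. *)
have [m3|m3] := leqP m 3.
  have m5 : m.+2 = 5 by lia.
  rewrite m5 in adm cR cC.
  apply: admissible_check check5 adm _ _ _; first by rewrite sL; nlia.
    move=> i s us Cs; rewrite /heavy (@sum_row _ _ s) //; last by move=> p /LC/Cs.
    have [_ //|] := posnP (rdeg L i); case/hr=> j ij; apply/orP; right.
    apply/hasP; exists (count_mem (i, j) L) => //.
    by apply: map_f; apply/Cs/(LC (i, j)); rewrite -has_pred1 has_count ltnW.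
  move=> j s us Rs; rewrite /heavy (@sum_col _ _ s) //; last by move=> p /LR/Rs.
  have [_ //|] := posnP (cdeg L j); case/hc=> i ij; apply/orP; right.
  apply/hasP; exists (count_mem (i, j) L) => //.
  apply: (map_f (fun i => count_mem (i, j) L)).
  by apply/Rs/(LR (i, j)); rewrite -has_pred1 has_count ltnW.
have {}IH := IH m3.
have adm' := admissible_swap adm.
have hr' j : 0 < rdeg (map swap L) j -> exists i, 1 < count_mem (j, i) (map swap L).
  by rewrite rdeg_swap => /hc[i ij]; exists i; rewrite count_mem_swap.
case: (pickP (fun k => [&& k \in R, k != a & rdeg L k == 0])) => [a'|posR].
  case/and3P=> a'R a'a /eqP a'0.
  case: (pickP (fun k => [&& k \in C, k != b & cdeg L k == 0])) => [b'|posC].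
    case/and3P=> b'C b'b /eqP b'0.
    exact: (routable_heavy_two IH adm m3 sL hr hc a'R aR a'a b'C bC b'b).
  (* Two empty rows and a single empty column: the transpose of the case treated above. *)
  apply: routable_swapK.
  apply: (routable_heavy_one_two IH adm' m3 _ hr' bC _ _ a'R aR a'a);
    rewrite ?size_map ?rdeg_swap ?cdeg_swap //.
  by move=> j jC jb; rewrite rdeg_swap lt0n; have := posC j; rewrite jC jb /= => ->.
have rpos : {in R, forall i, i != a -> 0 < rdeg L i}.
  by move=> i iR ia; rewrite lt0n; have := posR i; rewrite iR ia /= => ->.
case: (pickP (fun k => [&& k \in C, k != b & cdeg L k == 0])) => [b'|posC].
  case/and3P=> b'C b'b /eqP b'0.
  exact: (routable_heavy_one_two IH adm m3 sL hr aR a0 rpos b'C bC b'b).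
apply: (routable_heavy_one_one IH adm m3 sL hr hc aR bC a0 b0 rpos).
by move=> j jC jb; rewrite lt0n; have := posC j; rewrite jC jb /= => ->.
Qed.

(** Otherwise there would be at least [m * m] demands. Such a row leaves room for padding. *)
Lemma exists_low_row (A B : finType) m (R : {set A}) (L : seq (A * B)) :
  0 < m -> #|R| = m -> {in L, forall p, p.1 \in R} -> size L < 2 * m - 2 ->
  exists2 i, i \in R & rdeg L i < m.
Proof.
move=> m0 cR LR sL; have := sum_rdeg LR.
case: (pickP (fun i => (i \in R) && (rdeg L i < m))) => [i /andP[]|high].
  by exists i.
have : \sum_(i in R) m <= \sum_(i in R) rdeg L i.
  by apply: leq_sum => i iR; have := high i; rewrite iR /= ltnNge => /negbFE.
by rewrite sum_nat_const cR => H E; rewrite E in H; nia.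
Qed.

Lemma all_routableP m : 3 < m -> all_routable m.
Proof.
have [n] := ubnP m; elim: n m => // n IHn m mn m_ge A B R C L adm.
(* An inner induction on the number of missing demands pads [L]; an added demand is dropped again
   from the routing. *)
have [k] := ubnP (2 * m - 2 - size L); elim: k L adm => // k IHk L adm Lk.
have [cR cC LR LC sL rL cL] := adm.
have sw : {in map swap L, forall p, p.1 \in C} by move=> _ /mapP[p /LC ? ->].
have [lt|ge] := ltnP (size L) (2 * m - 2).
  have [|i iR ri] := exists_low_row _ cR LR lt; first by nlia.
  have [||j jC] := exists_low_row _ cC sw; rewrite ?size_map //; first by nlia.
  rewrite rdeg_swap => cj; apply: (@routable_drop _ _ _ _ _ (i, j)); apply: IHk.
    split=> //.
    - by move=> p; rewrite in_cons => /predU1P[->|/LR].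
    - by move=> p; rewrite in_cons => /predU1P[->|/LC].
    - by move=> u; rewrite rdeg_cons /=; have := rL u; case: eqP => [<-|_]; nlia.
    - by move=> u; rewrite cdeg_cons /=; have := cL u; case: eqP => [<-|_]; nlia.
  by rewrite /=; nlia.
have {sL ge} sL : size L = 2 * m - 2 by nlia.
have [m4|m4] := leqP m 4.
  have E : m = 4 by nlia.
  by rewrite E in adm sL; apply: admissible_check check4 adm sL _ _.
case: m mn m4 {m_ge Lk IHk} => // m mn m4 in adm sL cR cC rL cL *.
have IH : all_routable m by apply: IHn; nlia.
have adm' := admissible_swap adm.
case: (pickP (fun a => (a \in R) && (rdeg L a == 0))) => [a /andP[aR /eqP a0]|posR].
  have [//|[[b bC b0] hc]] := zero_row_step IH m4 adm aR a0.
  have b0' : rdeg (map swap L) b = 0 by rewrite rdeg_swap.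
  have [S|[_ hr]] := zero_row_step IH m4 adm' bC b0'.
    exact: (@routable_swapK _ _ _ _ [::]).
  case: m mn m4 adm sL {IH adm' cR cC rL cL} => // m mn m4 adm sL.
  apply: (routable_heavy _ m4 adm _ _ hc aR a0 bC b0).
  - by move=> m3; apply: IHn => //; nlia.
  - by rewrite sL; nlia.
  by move=> i; rewrite -cdeg_swap => /hr[j ij]; exists j; rewrite -count_mem_swap.
have rpos : {in R, forall i, 0 < rdeg L i}.
  by move=> i iR; rewrite lt0n; have := posR i; rewrite iR /= => ->.
case: (pickP (fun b => (b \in C) && (cdeg L b == 0))) => [b /andP[bC /eqP b0]|posC].
  have b0' : rdeg (map swap L) b = 0 by rewrite rdeg_swap.
  (* In the transposed grid the second alternative would give an empty row, which is excluded
     here. *)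
  have [S|[[a aR]]] := zero_row_step IH m4 adm' bC b0'.
    exact: (@routable_swapK _ _ _ _ [::]).
  by rewrite cdeg_swap => a0; have := rpos _ aR; rewrite a0.
apply: (routable_no_zero IH adm m4) => // j jC.
by rewrite lt0n; have := posC j; rewrite jC /= => ->.
Qed.

(** * From routings of the grid to edge-disjoint paths *)

Lemma routable_resolvable n (D : multigraph (Knn n)) (h : edge D -> 'I_n * 'I_n) :
    (forall e, ends e = [set (inl (h e).1 : Knn n); (inr (h e).2 : Knn n)]) ->
    routable [set: 'I_n] [set: 'I_n] [::] (map h (enum (edge D))) ->
  resolvable D.
Proof.
move=> hP [f fP].
pose X (e : edge D) p := f p == index e (enum (edge D)).
have path_for e : exists w : Knn n * seq (Knn n),
    [/\ is_path w, path_ends w = ends e &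
     forall a, a \in path_edges w -> exists2 p, X e p & a = [set inl p.1; inr p.2]].
  have eE : index e (enum (edge D)) < size (enum (edge D)).
    by rewrite index_mem mem_enum.
  have := fP (h e) (index e (enum (edge D))); rewrite size_map => /(_ eE).
  rewrite (nth_map e) // nth_index ?mem_enum //.
  rewrite /joined; set Y := fun p => _.
  have YX p : Y p -> X e p by case/andP.
  (* Shortening the walk removes repeated vertices, and the remaining edges keep the colour of
     [e]. *)
  case/connectP=> s0 /shortenP[s sP us _] Es.
  exists (inl (h e).1, s); split.
  - rewrite /is_path us andbT; apply: sub_path sP.
    by move=> [u|u] [v|v].
  - by rewrite hP /path_ends /= -Es.
  move=> a; rewrite /path_edges /=; move: (inl _ : 'I_n + 'I_n)%type s sP {us Es s0}.
  move=> x s; elim: s x => //= y s IHs x /andP[xy /IHs{}IHs].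
  rewrite in_cons => /predU1P[->|/IHs //].
  case: x y xy {IHs} => [u|u] [v|v] //= /YX uv; first by exists (u, v).
  by exists (v, u) => //; rewrite setUC.
have [P PP] := fin_all_exists path_for.
exists P; split=> [e|e e' ee' a ae]; first by have [] := PP e.
apply/negP => ae'; have [_ _ /(_ _ ae)[p pX aE]] := PP e.
have [_ _ /(_ _ ae')[q qX aE']] := PP e'.
(* A shared edge determines its cell, which has only one colour, and the colour determines the
   demand. *)
have pq : p = q.
  have /setP E : [set inl p.1; inr p.2] = [set inl q.1; inr q.2] :> {set 'I_n + 'I_n}.
    by rewrite -aE.
  have := E (inl p.1); have := E (inr p.2); rewrite !inE /= !eqxx /= ?orbT.
  case: p q {pX aE qX aE' E} => [u v] [u' v'] /= /esym + /esym.
  by rewrite /eq_op /= ?orbF => /eqP-> /eqP->.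
move: pX qX; rewrite /X -pq => /eqP-> /eqP Ei.
move/negP: ee'; case; apply/eqP.
by rewrite -[e](nth_index e (mem_enum _ e)) Ei nth_index ?mem_enum.
Qed.

Theorem theorem3 (n : nat) (hn : 4 <= n) (D : multigraph (Knn n))
    (hbip : bipartite_demand D)
    (hsize : #|edge D| <= 2 * n - 2)
    (hdeg : max_degree D <= n) :
  resolvable D.
Proof.
have /fin_all_exists[h hP] : forall e : edge D, exists p : 'I_n * 'I_n,
    ends e = [set (inl p.1 : Knn n); (inr p.2 : Knn n)].
  by move=> e; have [i [j ->]] := hbip e; exists (i, j).
have degn v : degree D v <= n by apply: leq_trans hdeg; apply: leq_bigmax.
apply: (routable_resolvable hP); apply: (all_routableP hn); split.
- by rewrite cardsT card_ord.
- by rewrite cardsT card_ord.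
- by move=> p; rewrite inE.
- by move=> p; rewrite inE.
- by rewrite size_map -cardE.
(* The demands in row [i] come from distinct edges of [D] incident to [inl i]. *)
- move=> i; apply: leq_trans (degn (inl i)).
  rewrite /rdeg count_map -size_filter /degree cardE.
  apply: uniq_leq_size => [|e]; first by rewrite filter_uniq ?enum_uniq.
  by rewrite mem_filter => /andP[/eqP<- _]; rewrite mem_enum inE hP !inE eqxx.
move=> j; apply: leq_trans (degn (inr j)).
rewrite /cdeg count_map -size_filter /degree cardE.
apply: uniq_leq_size => [|e]; first by rewrite filter_uniq ?enum_uniq.
by rewrite mem_filter => /andP[/eqP<- _]; rewrite mem_enum inE hP !inE eqxx orbT.
Qed.
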